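(* For every integer $n\geq 3$, the algebraic variety $\mathrm{LeibN}^n$ of nilpotent Leibniz algebra laws on $\mathbb{C}^n$ is reducible.
   Context: A Leibniz algebra law on $\mathbb{C}^n$ is a bilinear map $\mu:\mathbb{C}^n\times\mathbb{C}^n\to\mathbb{C}^n$ satisfying $\mu(x,\mu(y,z))=\mu(\mu(x,y),z)-\mu(\mu(x,z),y)$ for all $x,y,z$. Put $\mathcal{C}^1=\mathbb{C}^n$ and $\mathcal{C}^{k+1}=\mu(\mathcal{C}^k,\mathbb{C}^n)$ (the span of the products); $\mu$ is nilpotent if $\mathcal{C}^k=\{0\}$ for some $k$. $\mathrm{LeibN}^n$ denotes the set of nilpotent Leibniz algebra laws on $\mathbb{C}^n$; identifying a law with its structure constants $(a_{ij}^k)$, $\mu(e_i,e_j)=\sum_k a_{ij}^k e_k$, in a fixed basis, it is an algebraic subset of $\mathbb{C}^{n^3}$. Reducible means not irreducible in the Zariski topology. *)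

(* Defs.v *)
From HB Require Import structures.
From mathcomp Require Import all_boot all_order all_algebra.
From mathcomp Require Import boolp classical_sets reals.
From mathcomp Require Import complex.
From mathcomp Require Import mpoly.

Set Implicit Arguments.
Unset Strict Implicit.
Unset Printing Implicit Defensive.

Import GRing.Theory.
Local Open Scope ring_scope.
Local Open Scope classical_set_scope.

Section ZariskiTopology.
Variables (K : fieldType) (I : finType).

(* The coordinates of the affine space {ffun I -> K} are indexed by I; the
   k-th indeterminate of {mpoly K[#|I|]} is the coordinate enum_val k. *)
Definition peval (p : {mpoly K[#|I|]}) (a : {ffun I -> K}) : K :=
  p.@[fun k => a (enum_val k)].

Definition zero_locus (S : set {mpoly K[#|I|]}) : set {ffun I -> K} :=
  [set a | forall p, S p -> peval p a = 0].

Definition zariski_closed (Z : set {ffun I -> K}) : Prop :=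
  exists S : set {mpoly K[#|I|]}, Z = zero_locus S.

(* Closed for the topology induced on X by the Zariski topology. *)
Definition zariski_closed_in (X Y : set {ffun I -> K}) : Prop :=
  exists2 Z, zariski_closed Z & Y = X `&` Z.

Definition zariski_irreducible (X : set {ffun I -> K}) : Prop :=
  X !=set0 /\
  forall Y1 Y2 : set {ffun I -> K},
    zariski_closed_in X Y1 -> zariski_closed_in X Y2 ->
    X = Y1 `|` Y2 -> Y1 = X \/ Y2 = X.

Definition zariski_reducible (X : set {ffun I -> K}) : Prop :=
  ~ zariski_irreducible X.

End ZariskiTopology.

Section NilpotentLeibnizLaws.
Variables (K : fieldType) (n : nat).
Local Notation V := 'rV[K]_n.

Definition leibniz_law (mu : {bilinear V -> V -> V}) : Prop :=
  forall x y z : V, mu x (mu y z) = mu (mu x y) z - mu (mu x z) y.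

Definition linear_span (S : set V) : set V :=
  [set v | exists (m : nat) (c : 'I_m -> K) (s : 'I_m -> V),
     (forall i, S (s i)) /\ v = \sum_(i < m) c i *: s i].

(* The numbering starts at 0: lower_series mu k is the term C^(k+1) of the
   usual series C^1 = V, C^(k+1) = mu(C^k, V). *)
Fixpoint lower_series (mu : {bilinear V -> V -> V}) (k : nat) : set V :=
  if k is k'.+1 then
    linear_span [set v | exists x y : V, lower_series mu k' x /\ v = mu x y]
  else setT.

Definition nilpotent_law (mu : {bilinear V -> V -> V}) : Prop :=
  exists k : nat, lower_series mu k = [set 0].

(* The coordinate (i, j, k) is the coefficient of e_k in mu(e_i, e_j), where
   e_i = delta_mx 0 i is the canonical basis. *)
Definition structure_constants (mu : {bilinear V -> V -> V}) :
    {ffun 'I_n * 'I_n * 'I_n -> K} :=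
  [ffun t => mu (delta_mx 0 t.1.1) (delta_mx 0 t.1.2) 0 t.2].

Definition LeibN : set {ffun 'I_n * 'I_n * 'I_n -> K} :=
  [set a | exists mu : {bilinear V -> V -> V},
     [/\ leibniz_law mu, nilpotent_law mu & a = structure_constants mu]].

End NilpotentLeibnizLaws.

Arguments LeibN : clear implicits.

(* Main.v *)
Require Import Defs.
From mathcomp Require Import all_boot all_order all_algebra.
From mathcomp Require Import boolp classical_sets reals complex mpoly.
From HB Require Import structures.

(** Write R_x for right multiplication z |-> mu(z, x). The variety of nilpotent
    Leibniz laws is covered by two closed sets, and neither contains it.

    - [top_power_vanishes]: the laws with R_x^(n-1) x = 0 for every x.
    - [right_mul_rank_le1]: the laws whose operators R_y are pairwise
      proportional, expressed by 2 x 2 minors of the structure constants.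

    The covering ([LeibN_cover]) is where the Leibniz identity is used. Suppose
    R_x^(n-1) x is nonzero for some x. Since R_x acts nilpotently on x, the
    vectors x, R_x x, ..., R_x^(n-1) x are independent, hence span the space
    ([krylov_span]). The Leibniz identity says R_(mu(y,x)) = [R_x, R_y], so
    R_(mu(x,x)) = [R_x, R_x] = 0 and, by induction, R_c = 0 for every further
    c = R_x^k x ([leibniz_right_power0]). If c_0 is the coefficient of x in y,
    this gives R_y = c_0 R_x, and all right multiplications are proportional.

    Neither set suffices. The null-filiform law e_i e_0 = e_(i+1) has
    R_(e_0)^(n-1) e_0 = e_(n-1), which is nonzero ([null_filiform_top_power]).
    The law e_0 e_0 = e_1 e_1 = e_(n-1) has independent R_(e_0) and R_(e_1)
    ([square_sum_rank_gt1]); it is nilpotent because n >= 3 makes e_(n-1)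
    different from e_0 and e_1, so that all triple products vanish. *)

Set Implicit Arguments.
Unset Strict Implicit.
Unset Printing Implicit Defensive.

Import GRing.Theory.
Local Open Scope ring_scope.
Local Open Scope classical_set_scope.

(** * Polynomial functions and Zariski-closed sets *)

Section PolynomialFunctions.
Variables (K : fieldType) (I : finType).
Implicit Types f g : {ffun I -> K} -> K.

(** Closedness is proved through functions rather than through explicit elements
    of [{mpoly K[#|I|]}], so that coordinates keep their index in [I]. *)
Definition polynomial_fun f := exists p, forall a, peval p a = f a.

Lemma polynomial_fun_const c : polynomial_fun (fun=> c).
Proof. by exists c%:MP => a; rewrite /peval mevalC. Qed.

Lemma polynomial_fun_coord i : polynomial_fun (fun a => a i).
Proof. by exists 'X_(enum_rank i) => a; rewrite /peval mevalXU enum_rankK. Qed.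

Lemma polynomial_funB f g :
  polynomial_fun f -> polynomial_fun g -> polynomial_fun (fun a => f a - g a).
Proof.
by move=> [p pf] [q qg]; exists (p - q) => a; rewrite -pf -qg /peval mevalB.
Qed.

Lemma polynomial_funM f g :
  polynomial_fun f -> polynomial_fun g -> polynomial_fun (fun a => f a * g a).
Proof.
by move=> [p pf] [q qg]; exists (p * q) => a; rewrite -pf -qg /peval mevalM.
Qed.

Lemma polynomial_fun_sum (J : Type) (r : seq J) (F : J -> {ffun I -> K} -> K) :
  (forall j, polynomial_fun (F j)) ->
  polynomial_fun (fun a => \sum_(j <- r) F j a).
Proof.
move=> Fpoly; elim: r => [|j r [p pr]].
  by exists 0 => a; rewrite big_nil /peval meval0.
have [q qF] := Fpoly j.
by exists (q + p) => a; rewrite big_cons -qF -pr /peval mevalD.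
Qed.

Lemma zariski_closed_zeros (T : Type) (F : T -> {ffun I -> K} -> K) :
  (forall t, polynomial_fun (F t)) ->
  zariski_closed [set a | forall t, F t a = 0].
Proof.
move=> Fpoly; exists [set p | exists t, forall a, peval p a = F t a].
apply/seteqP; split=> a /=.
  by move=> Fa p /= [t pF]; rewrite pF.
by move=> Za t; have [p pF] := Fpoly t; rewrite -pF; apply: Za; exists t.
Qed.

Lemma zariski_reducible_cover (X Z1 Z2 : set {ffun I -> K}) :
  zariski_closed Z1 -> zariski_closed Z2 -> X `<=` Z1 `|` Z2 ->
  ~ X `<=` Z1 -> ~ X `<=` Z2 -> zariski_reducible X.
Proof.
move=> Z1c Z2c XZ XZ1 XZ2 [_ /(_ (X `&` Z1) (X `&` Z2))].
case; [by exists Z1 | by exists Z2 | | by move/setIidPl | by move/setIidPl].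
by rewrite -setIUr; apply/esym/setIidPl.
Qed.

End PolynomialFunctions.

(** * Cyclic vectors of a locally nilpotent operator *)

Section Krylov.
Variables (K : fieldType) (n : nat) (T : {linear 'rV[K]_n -> 'rV[K]_n}).

Lemma iter_linear_comb k m (c : 'I_m -> K) (s : 'I_m -> 'rV[K]_n) :
  iter k T (\sum_i c i *: s i) = \sum_i c i *: iter k T (s i).
Proof.
elim: k => //= k ->; rewrite linear_sum.
by apply: eq_bigr => i _; rewrite linearZ.
Qed.

Lemma iter_linear0 k : iter k T 0 = 0.
Proof. by elim: k => //= k ->; rewrite linear0. Qed.

(** In a relation between the vectors T^i x, applying T^(N-j) kills every term
    of index above j and turns the term of index j into a multiple of T^N x; the
    coefficients are thus seen to vanish one after the other, from index 0 up. *)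
Lemma krylov_row_free N x :
  iter N T x != 0 -> iter N.+1 T x = 0 ->
  row_free (\matrix_(i < N.+1) iter i T x).
Proof.
move=> TNx TN1x; have T0 k : (N < k)%N -> iter k T x = 0.
  by move=> /subnK <-; rewrite iterD TN1x iter_linear0.
apply: inj_row_free => u; rewrite mulmx_sum_row => u0.
apply/rowP => j; rewrite mxE.
have [d] := ubnP (j : nat); elim: d => // d IH in j * => /ltnSE jd.
have /eqP := congr1 (iter (N - j) T) u0.
rewrite iter_linear0 iter_linear_comb (bigD1 j) //= big1 => [|i ij].
  rewrite rowK -iterD subnK -1?ltnS // addr0 scaler_eq0 (negPf TNx) orbF.
  by move/eqP.
rewrite rowK -iterD; have [ltij|ltji|eqij] := ltngtP i j.
- by rewrite IH ?scale0r // (leq_trans ltij).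
- have jN : (j <= N)%N by rewrite -ltnS.
  by rewrite T0 ?scaler0 // -{1}(subnK jN) ltn_add2l.
- by rewrite (val_inj eqij) eqxx in ij.
Qed.

(** Cyclicity of x under an operator that is nilpotent on x. The length m + 1 of
    the combination is the least N with T^N x = 0. It equals n, but keeping it
    free avoids casting between matrix sizes: independence of the T^i x with
    i < N, together with N >= n, already makes them span. *)
Lemma krylov_span x v :
  iter n.-1 T x != 0 -> (exists k, iter k T x = 0) ->
  exists m (c : 'I_m.+1 -> K), v = \sum_i c i *: iter i T x.
Proof.
move=> Tx [k Tk].
have nilT : exists k, iter k T x == 0 by exists k; apply/eqP.
case: (ex_minnP nilT) => -[|N] /eqP TN minN.
  by move: TN Tx => /= ->; rewrite iter_linear0 eqxx.
have nN : (n <= N.+1)%N.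
  rewrite leqNgt; apply/negP => ltNn; case/eqP: Tx.
  have /subnK <- : (N.+1 <= n.-1)%N by rewrite -ltnS (ltn_predK ltNn).
  by rewrite iterD TN iter_linear0.
have free : row_free (\matrix_(i < N.+1) iter i T x).
  by apply: krylov_row_free => //; apply/negP => /minN; rewrite ltnn.
have full : row_full (\matrix_(i < N.+1) iter i T x).
  by rewrite -col_leq_rank (eqP free).
have /submxP[c ->] := submx_full v full.
exists N, (c 0); rewrite mulmx_sum_row.
by apply: eq_bigr => i _; rewrite rowK.
Qed.

End Krylov.

(** * Right multiplications of a nilpotent Leibniz law *)

Section Laws.
Variables (K : fieldType) (n : nat).
Local Notation V := 'rV[K]_n.
Implicit Types (mu : {bilinear V -> V -> V}) (x y z : V).

Lemma lower_series_iter mu x k : lower_series mu k (iter k (mu^~ x) x).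
Proof.
elim: k => //= k IH; exists 1, (fun=> 1), (fun=> mu (iter k (mu^~ x) x) x).
by split=> [_|]; [exists (iter k (mu^~ x) x), x | rewrite big_ord1 scale1r].
Qed.

Lemma nilpotent_law_iter mu x :
  nilpotent_law mu -> exists k, iter k (mu^~ x) x = 0.
Proof.
by move=> [k muk]; exists k; have := lower_series_iter mu x k; rewrite muk.
Qed.

(** In the notation R_x for [mu^~ x], the Leibniz identity reads
    R_(mu(y,x)) = R_x R_y - R_y R_x as operators composed from right to left.
    The commutator vanishes for y = x, and whenever R_y = 0. *)
Lemma leibniz_right_power0 mu x k z :
  leibniz_law mu -> mu z (iter k.+1 (mu^~ x) x) = 0.
Proof.
move=> leib; elim: k z => [|k IH] z; rewrite iterS leib; first exact: subrr.
by rewrite !IH linear0l subr0.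
Qed.

Lemma right_mul_proportional mu x :
  leibniz_law mu -> nilpotent_law mu -> iter n.-1 (mu^~ x) x != 0 ->
  forall y, exists c, forall z, mu z y = c *: mu z x.
Proof.
move=> leib nil x_top y.
have x_nil := nilpotent_law_iter x nil.
have [m [c ->]] := krylov_span (T := applyr mu x) y x_top x_nil.
exists (c ord0) => z.
rewrite linear_sumr big_ord_recl big1 ?addr0 ?linearZr_LR // => i _.
by rewrite linearZr_LR leibniz_right_power0 ?scaler0.
Qed.

(** Nilpotency criterion: multiplying on the right moves the flag of subspaces
    <e_k, ..., e_(n-1)> one step down. *)
Lemma nilpotent_of_flag mu :
  (forall (k : nat) x y, (forall j : 'I_n, (j < k)%N -> x 0 j = 0) ->
     forall j : 'I_n, (j <= k)%N -> mu x y 0 j = 0) ->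
  nilpotent_law mu.
Proof.
move=> mu_flag.
(* One more step than needed to reach 0, so that the term is a linear span even
   when n = 0. *)
exists n.+1.
have flag k x : lower_series mu k x -> forall j : 'I_n, (j < k)%N -> x 0 j = 0.
  elim: k x => // k IH x [m [c [s [sP ->]]]] j jk.
  rewrite summxE big1 // => i _; rewrite mxE.
  have [y [z [yk ->]]] := sP i.
  by rewrite (mu_flag k) ?mulr0 //; apply: IH.
apply/seteqP; split=> [x /flag x0|_ ->] /=.
  by apply/rowP => j; rewrite mxE x0 // ltnS ltnW.
by exists 0%N, (fun=> 0), (fun=> 0); split=> [[]|]; rewrite ?big_ord0.
Qed.

Definition array_mul (a : {ffun 'I_n * 'I_n * 'I_n -> K}) x y : V :=
  \row_k \sum_i \sum_j x 0 i * y 0 j * a (i, j, k).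

Lemma array_mulE mu x y : array_mul (structure_constants mu) x y = mu x y.
Proof.
apply/rowP => k; rewrite mxE [in RHS](row_sum_delta x) linear_sumlz summxE.
apply: eq_bigr => i _; rewrite linearZl_LR [in RHS](row_sum_delta y) linear_sumr.
rewrite scaler_sumr summxE; apply: eq_bigr => j _.
by rewrite linearZr_LR scalerA !mxE ffunE.
Qed.

Lemma iter_array_mul mu x k :
  iter k ((array_mul (structure_constants mu))^~ x) x = iter k (mu^~ x) x.
Proof. by apply: eq_iter => z; rewrite array_mulE. Qed.

Lemma polynomial_fun_iter_mul x t k :
  polynomial_fun (fun a => iter t ((array_mul a)^~ x) x 0 k).
Proof.
elim: t k => [|t IH] k; first exact: polynomial_fun_const.
have [p pE] : polynomial_fun (fun a => \sum_i \sum_j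
    iter t ((array_mul a)^~ x) x 0 i * x 0 j * a (i, j, k)).
  do 2![apply: polynomial_fun_sum => ?].
  by do 2?[apply: polynomial_funM => //];
     [exact: polynomial_fun_const | exact: polynomial_fun_coord].
by exists p => a; rewrite pE /= mxE.
Qed.

Definition top_power_vanishes : set {ffun 'I_n * 'I_n * 'I_n -> K} :=
  [set a | forall t : V * 'I_n,
     iter n.-1 ((array_mul a)^~ t.1) t.1 0 t.2 = 0].

(** The entry of R_(e_j) at (i, k) is a (i, j, k): for all i, k, i', k' these
    are the 2 x 2 minors of the pair (R_(e_j), R_(e_j')), seen as two vectors of
    length n^2. *)
Definition right_mul_minor (t : ('I_n * 'I_n) * ('I_n * 'I_n) * ('I_n * 'I_n))
    (a : {ffun 'I_n * 'I_n * 'I_n -> K}) : K :=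
  let: ((i, k), (i', k'), (j, j')) := t in
  a (i, j, k) * a (i', j', k') - a (i, j', k) * a (i', j, k').

Definition right_mul_rank_le1 : set {ffun 'I_n * 'I_n * 'I_n -> K} :=
  [set a | forall t, right_mul_minor t a = 0].

Lemma top_power_vanishes_closed : zariski_closed top_power_vanishes.
Proof. by apply: zariski_closed_zeros => t; apply: polynomial_fun_iter_mul. Qed.

Lemma right_mul_rank_le1_closed : zariski_closed right_mul_rank_le1.
Proof.
apply: zariski_closed_zeros => -[[[i k] [i' k']] [j j']].
by apply: polynomial_funB; apply: polynomial_funM; apply: polynomial_fun_coord.
Qed.

Lemma LeibN_cover : LeibN K n `<=` top_power_vanishes `|` right_mul_rank_le1.
Proof.
move=> _ [mu [leib nil ->]].
have [low|] := pselect (top_power_vanishes (structure_constants mu)).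
  by left.
move=> /existsNP[[x l] /= xl]; right => -[[[i k] [i' k']] [j j']].
have x_top : iter n.-1 (mu^~ x) x != 0.
  by apply/eqP => x0; apply: xl; rewrite iter_array_mul x0 mxE.
have prop := right_mul_proportional leib nil x_top.
have [c cE] := prop (delta_mx 0 j); have [c' cE'] := prop (delta_mx 0 j').
by rewrite /= !ffunE /= !cE !cE' !mxE mulrACA (mulrC c) -mulrACA subrr.
Qed.

End Laws.

(** * A law with a nonzero top power: the null-filiform law *)

Section NullFiliform.
Variables (K : fieldType) (n : nat).
Local Notation V := 'rV[K]_n.+1.

Definition shift (x : V) : V :=
  \row_j (if j == 0%N :> nat then 0 else x 0 (inord j.-1)).

Definition null_filiform (x y : V) : V := y 0 0 *: shift x.

Lemma shift_linear : linear shift.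
Proof.
by move=> c x y; apply/rowP => j; rewrite !mxE; case: ifP; rewrite ?mulr0 ?addr0.
Qed.

Lemma null_filiform_is_bilinear : bilinear_for *:%R *:%R null_filiform.
Proof.
split=> [y|x] c u v; rewrite /null_filiform.
  by rewrite /= shift_linear scalerDr !scalerA mulrC.
by rewrite /= !mxE scalerDl scalerA.
Qed.

HB.instance Definition _ :=
  bilinear_isBilinear.Build K V V V *:%R *:%R null_filiform
    null_filiform_is_bilinear.

Lemma null_filiform_leibniz : leibniz_law null_filiform.
Proof.
move=> x y z.
(* shift y has no component on e_0, so right multiplication by mu(y, z) is 0. *)
have shift0 u : shift u 0 0 = 0 by rewrite mxE.
have shiftZ c u : shift (c *: u) = c *: shift u.
  by apply/rowP => j; rewrite !mxE; case: ifP; rewrite ?mulr0.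
rewrite /= /null_filiform mxE shift0 mulr0 scale0r.
by rewrite !shiftZ !scalerA (mulrC (z 0 0)) addrN.
Qed.

Lemma null_filiform_nilpotent : nilpotent_law null_filiform.
Proof.
apply: nilpotent_of_flag => k x y x0 j jk; rewrite !mxE.
case: eqP => [|/eqP]; rewrite ?mulr0 // -lt0n => j0.
rewrite x0 ?mulr0 // inordK ?(prednK j0) //.
exact: ltnW.
Qed.

Lemma null_filiform_iter k :
  (k <= n)%N ->
  iter k (null_filiform^~ (delta_mx 0 0)) (delta_mx 0 0) = delta_mx 0 (inord k).
Proof.
elim: k => [|k IH] kn /=.
  by congr delta_mx; apply: val_inj; rewrite /= inordK.
rewrite IH ?(ltnW kn) // /null_filiform mxE !eqxx scale1r.
have k_ltn : (k < n.+1)%N by exact: ltnW.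
apply/rowP => j.
have j_ltn : (j.-1 < n.+1)%N := leq_ltn_trans (leq_pred j) (ltn_ord j).
rewrite !mxE /= -!val_eqE /= !inordK //.
by case: (nat_of_ord j) => [|i]; rewrite ?eqSS.
Qed.

Lemma null_filiform_top_power :
  ~ top_power_vanishes (structure_constants null_filiform).
Proof.
move=> /(_ (delta_mx 0 0, inord n)) /=.
rewrite iter_array_mul null_filiform_iter // mxE !eqxx.
by move/eqP; rewrite oner_eq0.
Qed.

End NullFiliform.

(** * A law with independent right multiplications *)

Section SquareSum.
Variables (K : fieldType) (m : nat).
Local Notation V := 'rV[K]_m.+3.

Definition square_sum (x y : V) : V :=
  (x 0 0 * y 0 0 + x 0 1 * y 0 1) *: delta_mx 0 ord_max.

Lemma square_sum_is_bilinear : bilinear_for *:%R *:%R square_sum.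
Proof.
split=> [y|x] c u v; rewrite /= /square_sum !mxE scalerA -scalerDl.
  by rewrite mulrDr !mulrDl !mulrA addrACA.
by rewrite !mulrDr addrACA !(mulrCA c).
Qed.

HB.instance Definition _ :=
  bilinear_isBilinear.Build K V V V *:%R *:%R square_sum square_sum_is_bilinear.

Lemma square_sum_leibniz : leibniz_law square_sum.
Proof.
have sq0 x y : (square_sum x y 0 0 = 0) * (square_sum x y 0 1 = 0).
  by rewrite !mxE !eqE /= !mulr0.
move=> x y z; rewrite /= {1 3 5}/square_sum !sq0.
by rewrite !mulr0 !mul0r addr0 scale0r subrr.
Qed.

Lemma square_sum_nilpotent : nilpotent_law square_sum.
Proof.
apply: nilpotent_of_flag => k x y x0 j jk; rewrite !mxE eqxx /=.
have [jmax|] := eqVneq j ord_max; last by rewrite mulr0.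
(* The last index is at least 2, so x has no component on e_0 and e_1. *)
have k2 : (1 < k)%N by apply: leq_trans jk; rewrite jmax.
by rewrite !x0 ?mul0r ?addr0 ?mul0r // ltnW.
Qed.

Lemma square_sum_rank_gt1 :
  ~ right_mul_rank_le1 (structure_constants square_sum).
Proof.
(* Coordinate n - 1 of e_0 e_0 and e_1 e_1, against that of e_0 e_1 and e_1 e_0. *)
move=> /(_ ((0, ord_max), (1, ord_max), (0, 1))) /=.
rewrite !ffunE /= !mxE !eqxx !eqE /= !(mulr0, mul0r, mulr1, addr0, add0r, subr0).
by move/eqP; rewrite oner_eq0.
Qed.

End SquareSum.

(** * Reducibility *)

Theorem theorem3 (R : realType) (n : nat) (hn : (3 <= n)%N) :
  zariski_reducible (LeibN R[i] n).
Proof.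
case: n hn => [|[|[|m]]] // _.
apply: (zariski_reducible_cover (top_power_vanishes_closed _ _)
         (right_mul_rank_le1_closed _ _) (@LeibN_cover _ _)) => sub.
  apply: (@null_filiform_top_power R[i] m.+2); apply: sub.
  exists (null_filiform (n := m.+2)); split=> //.
    exact: null_filiform_leibniz.
  exact: null_filiform_nilpotent.
apply: (@square_sum_rank_gt1 R[i] m); apply: sub.
exists (@square_sum _ m); split=> //.
  exact: square_sum_leibniz.
exact: square_sum_nilpotent.
Qed.
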